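(* Let $K$ be a field of characteristic $\neq2$ and let $A_\tau$ be the free braided associative algebra on $x_1,x_2$ with an involutive diagonal braiding $\tau=(q_{11},q_{12},q_{21},q_{22})$. Then: (1) $\mathrm{Aut}\,A_\tau=\mathrm{Aut}\,K\langle x_1,x_2\rangle$ if $q_{ij}=1$ for all $i,j$; (2) $\mathrm{Aut}\,A_\tau=G_{\mathrm{odd}}$ if $q_{ij}=-1$ for all $i,j$; (3) $\mathrm{Aut}\,A_\tau\cong(K^*\times K^* )\rtimes\mathbb{Z}_2$ if $q_{11}=q_{22}$, $q_{12}=q_{21}$ and $q_{11}q_{12}=-1$; (4) $\mathrm{Aut}\,A_\tau\cong G_4$ if $q_{12}=1$ and $q_{11}q_{22}=-1$; (5) $\mathrm{Aut}\,A_\tau\cong K^*\times K^*$ if $q_{12}\neq\pm1$, or if $q_{12}=-1$ and $q_{11}q_{22}=-1$.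
   Context: $A=K\langle x_1,x_2\rangle$ is the free associative algebra with unit on $x_1,x_2$; $\varphi=(f_1,f_2)$ denotes the algebra endomorphism with $\varphi(x_1)=f_1$, $\varphi(x_2)=f_2$. For $q_{ij}\in K$, the diagonal braiding $\tau=(q_{11},q_{12},q_{21},q_{22})$ on $A$ is the linear map $A\otimes A\to A\otimes A$ given on words $u,v$ by $(u\otimes v)\tau=q_{11}^{s_1t_1}q_{12}^{s_1t_2}q_{21}^{s_2t_1}q_{22}^{s_2t_2}\,(v\otimes u)$, where $s_i$ (resp. $t_i$) is the number of occurrences of $x_i$ in $u$ (resp. $v$); it is the unique braided-algebra extension of $x_i\otimes x_j\mapsto q_{ij}x_j\otimes x_i$. It is involutive iff $q_{11}^2=q_{22}^2=q_{12}q_{21}=1$. $A_\tau$ is $A$ equipped with $\tau$, and $\mathrm{Aut}\,A_\tau$ is the group of algebra automorphisms $\varphi$ of $A$ satisfying $(\varphi\otimes\varphi)((w)\tau)=((\varphi\otimes\varphi)(w))\tau$ for all $w\in A\otimes A$, viewed as a subgroup of $\mathrm{Aut}\,K\langle x_1,x_2\rangle$. $G_{\mathrm{odd}}$ is the group of automorphisms $(f_1,f_2)$ of $A$ with $f_1,f_2$ both in the linear span of words of odd length. $G_4=\{(\alpha_1x_1+g(x_2^2),\beta_2x_2)\mid\alpha_1,\beta_2\in K^*,\ g(x)\in K[x]\}\subseteq\mathrm{Aut}\,K\langle x_1,x_2\rangle$. In (3), $\mathbb{Z}_2$ acts on $K^*\times K^*$ by swapping the factors. *)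

(* Defs.v *)
From HB Require Import structures.
From mathcomp Require Import all_boot all_algebra.
From mathcomp Require Import finmap.
From mathcomp.multinomials Require Import monalg.

Set Implicit Arguments.
Unset Strict Implicit.
Unset Printing Implicit Defensive.

Import GRing.Theory.
Local Open Scope ring_scope.

(* The free associative unital algebra K<x_1,x_2>: the monoid algebra of   *)
(* the free monoid on the two letters 'I_2 (letter 0 = x_1, letter 1 = x_2) *)
Definition word := fmonom 'I_2.
Definition FA (K : fieldType) := {malg K[word]}.

Definition X (K : fieldType) (i : 'I_2) : FA K := << (fmu i : word) >>.
Definition x1 (K : fieldType) : FA K := X K ord0.
Definition x2 (K : fieldType) : FA K := X K ord_max.

Definition endo_pair (K : fieldType) := (FA K * FA K)%type.

Definition img (K : fieldType) (f : endo_pair K) (i : 'I_2) : FA K :=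
  if i == ord0 then f.1 else f.2.

Definition word_img (K : fieldType) (f : endo_pair K) (w : word) : FA K :=
  \prod_(i <- (w : seq 'I_2)) img f i.

Definition endo (K : fieldType) (f : endo_pair K) (p : FA K) : FA K :=
  \sum_(w <- msupp p) p@_w *: word_img f w.

(* composition of endomorphisms: endo (ecomp f g) = endo f \o endo g *)
Definition ecomp (K : fieldType) (f g : endo_pair K) : endo_pair K :=
  (endo f g.1, endo f g.2).

Definition is_aut (K : fieldType) (f : endo_pair K) : Prop :=
  bijective (endo f).

(* A (x) A, as the K-vector space with basis u (x) v, u, v words.         *)
Definition FA2 (K : fieldType) := {malg K[(word * word)%type]}.

Definition tens (K : fieldType) (a b : FA K) : FA2 K :=
  \sum_(u <- msupp a) \sum_(v <- msupp b) (a@_u * b@_v) *: << (u, v) >>.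

Definition tmap (K : fieldType) (f : endo_pair K) (t : FA2 K) : FA2 K :=
  \sum_(uv <- msupp t) t@_uv *: tens (endo f << uv.1 >>) (endo f << uv.2 >>).

Definition occ (w : word) (i : 'I_2) : nat := count_mem i (w : seq 'I_2).

Definition bcoef (K : fieldType) (q11 q12 q21 q22 : K) (u v : word) : K :=
  let s1 := occ u ord0 in let s2 := occ u ord_max in
  let t1 := occ v ord0 in let t2 := occ v ord_max in
  q11 ^+ (s1 * t1) * q12 ^+ (s1 * t2) * q21 ^+ (s2 * t1) * q22 ^+ (s2 * t2).

Definition braid (K : fieldType) (q11 q12 q21 q22 : K) (t : FA2 K) : FA2 K :=
  \sum_(uv <- msupp t)
     (t@_uv * bcoef q11 q12 q21 q22 uv.1 uv.2) *: << (uv.2, uv.1) >>.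

Definition AutT (K : fieldType) (q11 q12 q21 q22 : K) (f : endo_pair K) : Prop :=
  is_aut f /\
  forall t : FA2 K,
    tmap f (braid q11 q12 q21 q22 t) = braid q11 q12 q21 q22 (tmap f t).

Definition odd_span (K : fieldType) (p : FA K) : bool :=
  all (fun w : word => odd (size (w : seq 'I_2))) (msupp p).

Definition Godd (K : fieldType) (f : endo_pair K) : Prop :=
  is_aut f /\ odd_span f.1 /\ odd_span f.2.

Definition poly_x2sq (K : fieldType) (g : {poly K}) : FA K :=
  \sum_(i < size g) g`_i *: (x2 K ^+ (2 * i)).

Definition G4 (K : fieldType) (f : endo_pair K) : Prop :=
  exists (a1 b2 : K) (g : {poly K}),
    [/\ a1 != 0, b2 != 0 & f = (a1 *: x1 K + poly_x2sq g, b2 *: x2 K)].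

Definition group_iso (T T' : Type) (S : T -> Prop) (opS : T -> T -> T)
    (U : T' -> Prop) (opU : T' -> T' -> T') : Prop :=
  exists h : T -> T',
    [/\ forall x, S x -> U (h x),
        forall x y, S x -> S y -> h (opS x y) = opU (h x) (h y),
        forall x y, S x -> S y -> h x = h y -> x = y
      & forall z, U z -> exists x, S x /\ h x = z].

Definition KstarKstar (K : fieldType) (p : K * K) : Prop := p.1 != 0 /\ p.2 != 0.
Definition mulKK (K : fieldType) (p p' : K * K) : K * K := (p.1 * p'.1, p.2 * p'.2).

Definition swapKK (K : fieldType) (e : bool) (p : K * K) : K * K :=
  if e then (p.2, p.1) else p.
Definition SemiDir (K : fieldType) (x : (K * K) * bool) : Prop := KstarKstar x.1.
Definition mulSD (K : fieldType) (x y : (K * K) * bool) : (K * K) * bool :=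
  (mulKK x.1 (swapKK x.2 y.1), addb x.2 y.2).

(* Main.v *)
Require Import Defs.
From HB Require Import structures.
From mathcomp Require Import all_boot all_algebra.
From mathcomp Require Import finmap.
From mathcomp.multinomials Require Import monalg.
From mathcomp Require Import all_order ring zify.
Import GRing.Theory.
Local Open Scope ring_scope.

Set Implicit Arguments.
Unset Strict Implicit.
Unset Printing Implicit Defensive.

(* An automorphism f is braided iff chi u v = chi x_k x_l for all words u of f_k
   and v of f_l, where chi is the bicharacter of tau.  Order words by weight,
   then size, then lexicographically, and let u, v be the leading words of f_1,
   f_2.  Either u and v are powers of one word, or they freely generate a free
   monoid; then leading words never cancel in p(f_1, f_2), so that writing x_1
   and x_2 in this form forces {u, v} = {x_1, x_2}.
   In cases (3) and (5) the values of chi exclude a common root of u and v, hence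
   f is linear, and then monomial.  In case (4), one of f_1, f_2, say f_i, is even
   in the letter x_j, and the other one, f_j, is odd in it.  For weights with
   wt x_j <= 0 <= wt x_i, not both 0, for which no word of f_i (f_j) is heavier
   than x_i (x_j), the signs exclude a common root, hence x_i and x_j are the
   leading words.  Tilting the weights from (0, -1) towards (1, 0) until a
   further word reaches the maximal weight shows that there is no further word,
   except for the powers of x_j in f_i. *)

(** * Linear extension from basis words to a monoid algebra *)

Section LinearExtension.
Variables (K : fieldType) (T : choiceType) (V : lmodType K).
Implicit Types (h : T -> V) (p q : {malg K[T]}).

(** [endo] and [tmap] are instances of this map by conversion and take their linearity from it. *)
Definition lext h p : V := \sum_(w <- msupp p) p@_w *: h w.

Lemma lextEw h (d : {fset T}) p :
  (msupp p `<=` d)%fset -> lext h p = \sum_(w <- d) p@_w *: h w.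
Proof.
move=> le; rewrite /lext; apply: big_fset_incl => // w _.
by rewrite -mcoeff_eq0 => /eqP ->; rewrite scale0r.
Qed.

Lemma lext_linear h : linear (lext h).
Proof.
move=> c p q; pose d := (msupp p `|` msupp q `|` msupp (c *: p + q))%fset.
have [le1 le2 le3] :
    [/\ msupp p `<=` d, msupp q `<=` d & msupp (c *: p + q) `<=` d]%fset.
  by split; apply/fsubsetP => w; rewrite !inE => ->; rewrite ?orbT.
rewrite !(@lextEw h d) // scaler_sumr -big_split /=.
by apply: eq_bigr => w _; rewrite mcoeffD mcoeffZ scalerDl scalerA.
Qed.

HB.instance Definition _ h :=
  GRing.isLinear.Build K {malg K[T]} V *:%R (lext h) (lext_linear h).

Lemma lextU h w : lext h << w >> = h w.
Proof.
by rewrite /lext msuppU oner_eq0 big_seq_fset1 mcoeffUU scale1r.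
Qed.

Lemma malg_linearE p : p = \sum_(w <- msupp p) p@_w *: << w >>.
Proof.
rewrite {1}(monalgE p); apply: eq_bigr => w _.
by apply/malgP => k; rewrite mcoeffZ !mcoeffU mulr_natr.
Qed.

Lemma eq_linear_malg (F G : {linear {malg K[T]} -> V}) :
  (forall w, F << w >> = G << w >>) -> F =1 G.
Proof.
move=> eqFG p; rewrite (malg_linearE p) !linear_sum.
by apply: eq_bigr => w _; rewrite !linearZ eqFG.
Qed.

(** Linearity is a hypothesis here, to serve for maps such as [fun p => endo f (p * q)] that carry
    no declared linear structure. *)
Lemma linear_malg_ext (F G : {malg K[T]} -> V) : linear F -> linear G ->
  (forall w, F << w >> = G << w >>) -> forall p, F p = G p.
Proof.
move=> linF linG; pose lF := GRing.isLinear.Build K {malg K[T]} V *:%R F linF.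
pose lG := GRing.isLinear.Build K {malg K[T]} V *:%R G linG.
pose F' : {linear _ -> _} := HB.pack F lF; pose G' : {linear _ -> _} := HB.pack G lG.
exact: (@eq_linear_malg F' G').
Qed.
End LinearExtension.

(** Scalars are central even when [M] is not commutative: both products are expanded over one set
    containing the supports of [q] and [c *: q]. *)
Lemma malg_scaleAr (K : fieldType) (M : monomType) (c : K) (p q : {malg K[M]}) :
  p * (c *: q) = c *: (p * q).
Proof.
pose d := (msupp q `|` msupp (c *: q))%fset.
have le1 : (msupp q `<=` d)%fset by exact: fsubsetUl.
have le2 : (msupp (c *: q) `<=` d)%fset by exact: fsubsetUr.
apply/malgP => k; rewrite mcoeffZ.
rewrite (mcoeffMlw k (fsubset_refl (msupp p)) le1).
rewrite (mcoeffMlw k (fsubset_refl (msupp p)) le2).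
rewrite mulr_sumr; apply: eq_bigr => k1 _; rewrite mulr_sumr.
by apply: eq_bigr => k2 _; rewrite mcoeffZ mulrnAr mulrCA.
Qed.

(** * Endomorphisms of the free algebra and their composition *)

Section FreeAlgebra.
Variable K : fieldType.
Implicit Types (f g : endo_pair K) (p q : FA K) (u v w z : word) (i : 'I_2).

Lemma word_eqP u v : reflect (u = v :> seq _) (u == v).
Proof. by rewrite fmP; apply: eqP. Qed.

Lemma word_inj u v : u = v :> seq _ -> u = v.
Proof. by move/word_eqP/eqP. Qed.

Lemma malgU_mul u v : << u >> * << v >> = << (mmul u v) >> :> FA K.
Proof. by rewrite malgM_def fgmulUU mulr1. Qed.

HB.instance Definition _ f :=
  GRing.isLinear.Build K (FA K) (FA K) *:%R (endo f) (lext_linear (word_img f)).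

Lemma endoU f w : endo f << w >> = word_img f w.
Proof. exact: lextU. Qed.

Lemma endoX f i : endo f (X K i) = img f i.
Proof. by rewrite endoU /word_img fmU big_seq1. Qed.

Lemma word_imgM f u v : word_img f (mmul u v) = word_img f u * word_img f v.
Proof. by rewrite /word_img fmM big_cat. Qed.

Lemma endo1 f : endo f 1 = 1.
Proof. by rewrite endoU /word_img fm1 big_nil. Qed.

(** Both sides are linear in [p] and in [q], which reduces the claim to words, where it is
    [word_imgM]. *)
Lemma endoM f p q : endo f (p * q) = endo f p * endo f q.
Proof.
have lin1 : linear (fun p => endo f (p * q)).
  by move=> c a b; rewrite mulrDl -scalerAl linearP.
have lin2 : linear (fun p => endo f p * endo f q).
  by move=> c a b; rewrite linearP mulrDl -scalerAl.
apply: (linear_malg_ext lin1 lin2) => u; move: q {lin1 lin2}.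
have lin3 : linear (fun q => endo f (<< u >> * q)).
  by move=> c a b; rewrite mulrDr malg_scaleAr linearP.
have lin4 : linear (fun q => endo f << u >> * endo f q).
  by move=> c a b; rewrite linearP mulrDr malg_scaleAr.
by apply: (linear_malg_ext lin3 lin4) => v; rewrite malgU_mul !endoU word_imgM.
Qed.

HB.instance Definition _ f :=
  GRing.isMonoidMorphism.Build (FA K) (FA K) (endo f) (conj (endo1 f) (@endoM f)).

Lemma img_ecomp f g i : img (ecomp f g) i = endo f (img g i).
Proof. by rewrite /img; case: ifP. Qed.

Lemma endo_ecomp f g p : endo (ecomp f g) p = endo f (endo g p).
Proof.
apply: (@eq_linear_malg _ _ _ (endo (ecomp f g)) (endo f \o endo g)) => w /=.
rewrite !endoU /word_img rmorph_prod.
by apply: eq_bigr => i _; rewrite img_ecomp.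
Qed.

Lemma img_inj f g : img f =1 img g -> f = g.
Proof.
case: f g => [a b] [a' b'] e; have := e ord0; have := e ord_max.
by rewrite /img /= => -> ->.
Qed.

Definition eid : endo_pair K := (x1 K, x2 K).

Lemma ord2E i : i = ord0 \/ i = ord_max.
Proof. by case: i => [[|[|//]]] h; [left|right]; apply: val_inj. Qed.

Lemma img_eid i : img eid i = X K i.
Proof. by case: (ord2E i) => ->. Qed.

Lemma endo_eid p : endo eid p = p.
Proof.
apply: (@eq_linear_malg _ _ _ (endo eid) idfun) => w /=; rewrite endoU.
have -> : w = FMonom w by case: w.
elim: (w : seq _) => [|i s IH]; first by rewrite /word_img big_nil -fmoneE.
rewrite /word_img big_cons img_eid -/(word_img eid (FMonom s)) IH malgU_mul.
by congr (<< _ >>); apply: word_inj; rewrite fmM fmU.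
Qed.

Lemma aut_cancel f g : ecomp f g = eid -> ecomp g f = eid -> is_aut f.
Proof.
by move=> fg gf; exists (endo g) => p; rewrite -endo_ecomp ?fg ?gf endo_eid.
Qed.

Lemma aut_comp f g : is_aut f -> is_aut g -> is_aut (ecomp f g).
Proof.
by move=> bf bg; apply: (eq_bij (bij_comp bf bg)) => p; rewrite endo_ecomp.
Qed.
End FreeAlgebra.

(** * Braided endomorphisms in terms of supports *)

Section Braiding.
Variables (K : fieldType) (q11 q12 q21 q22 : K).
Implicit Types (f g : endo_pair K) (p q : FA K) (u v w z : word) (i k l : 'I_2).
Local Notation chi := (bcoef q11 q12 q21 q22).
Local Notation tau := (braid q11 q12 q21 q22).

Lemma occM u v i : occ (mmul u v) i = (occ u i + occ v i)%N.
Proof. by rewrite /occ fmM count_cat. Qed.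

Lemma occ1 i : occ (mone : word) i = 0%N.
Proof. by rewrite /occ fm1. Qed.

Lemma occU k i : occ (fmu k) i = (k == i).
Proof. by rewrite /occ fmU /= addn0. Qed.

Lemma bcoefMl u v w : chi (mmul u v) w = chi u w * chi v w.
Proof. by rewrite /bcoef !occM !mulnDl !exprD; ring. Qed.

Lemma bcoefMr u v w : chi u (mmul v w) = chi u v * chi u w.
Proof. by rewrite /bcoef !occM !mulnDr !exprD; ring. Qed.

Lemma bcoef1l u : chi mone u = 1.
Proof. by rewrite /bcoef !occ1 !mul0n !expr0 !mulr1. Qed.

Lemma bcoef1r u : chi u mone = 1.
Proof. by rewrite /bcoef !occ1 !muln0 !expr0 !mulr1. Qed.

Lemma mcoeff_tens p q u v : (tens p q)@_(u, v) = p@_u * q@_v.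
Proof.
rewrite /tens raddf_sum /=.
have E s t : ((p@_s * q@_t) *: << (s, t) >> : FA2 K)@_(u, v)
    = (p@_s * (s == u)%:R) * (q@_t * (t == v)%:R).
  by rewrite mcoeffZ mcoeffU xpair_eqE -mulnb natrM; ring.
have S r x : \sum_(s <- msupp r) (r@_s * (s == x)%:R) = r@_x :> K.
  rewrite [in RHS](malg_linearE r) raddf_sum /=; apply: eq_bigr => s _.
  by rewrite mcoeffZ mcoeffU.
rewrite -(S _ p u) -(S _ q v) mulr_suml; apply: eq_bigr => s _.
by rewrite raddf_sum mulr_sumr /=; apply: eq_bigr => t _; rewrite E.
Qed.

Lemma braid_lext t :
  tau t = lext (fun uv => chi uv.1 uv.2 *: (<< (uv.2, uv.1) >> : FA2 K)) t.
Proof. by apply: eq_bigr => uv _; rewrite scalerA. Qed.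

Lemma mcoeff_braid t u v : (tau t)@_(v, u) = t@_(u, v) * chi u v.
Proof.
rewrite [in RHS](malg_linearE t) /braid !raddf_sum mulr_suml /=.
apply: eq_bigr => -[a b] _; rewrite !mcoeffZ !mcoeffU /= !xpair_eqE andbC.
by case: eqP => [->|] /=; [case: eqP => [->|]|] => *; rewrite ?mulr1 ?mulr0 ?mul0r.
Qed.

Definition braided f := forall k l u v,
  u \in msupp (img f k) -> v \in msupp (img f l) ->
  chi u v = chi (fmu k) (fmu l).

Lemma word_img_mone f : word_img f mone = 1.
Proof. by rewrite /word_img fm1 big_nil. Qed.

Lemma word_imgU f i : word_img f (fmu i) = img f i.
Proof. by rewrite /word_img fmU big_seq1. Qed.

Lemma word_rect (P : word -> Prop) :
  P mone -> (forall i w, P w -> P (mmul (fmu i) w)) -> forall w, P w.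
Proof.
move=> P1 PM w; have -> : w = FMonom w by case: w.
elim: (w : seq _) => [|i s IH]; first by rewrite -fmoneE.
have -> : FMonom (i :: s) = mmul (fmu i) (FMonom s).
  by apply: word_inj; rewrite fmM fmU.
exact: PM.
Qed.

(** Since [chi] is multiplicative in each argument, the condition passes from letters to words,
    first in [p], then in [q]. *)
Lemma braided_words f (p q u v : word) : braided f ->
  u \in msupp (word_img f p) -> v \in msupp (word_img f q) -> chi u v = chi p q.
Proof.
move=> bf; elim/word_rect: p u => [|k p IH] u.
  by rewrite word_img_mone (msuppU1 K) inE => /eqP -> _; rewrite !bcoef1l.
rewrite word_imgM word_imgU => /msuppM_le [u1 [u2 [uk up ->]]] vq.
rewrite !bcoefMl (IH u2) //; congr (_ * _).
elim/word_rect: q v vq {p IH u u2 up} => [|l q IH] v.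
  by rewrite word_img_mone (msuppU1 K) inE => /eqP -> ; rewrite !bcoef1r.
rewrite word_imgM word_imgU => /msuppM_le [v1 [v2 [vl vq ->]]].
by rewrite !bcoefMr (IH v2) // (bf k l).
Qed.

Lemma tmapU f u v : tmap f << (u, v) >> = tens (word_img f u) (word_img f v).
Proof. by rewrite [LHS]lextU /= !endoU. Qed.

Lemma braidU u v : tau << (u, v) >> = chi u v *: << (v, u) >>.
Proof. by rewrite braid_lext lextU. Qed.

Lemma tmap_linear f : linear (tmap f).
Proof. exact: lext_linear. Qed.

Lemma braid_linear : linear tau.
Proof. by move=> c a b; rewrite !braid_lext linearP. Qed.

HB.instance Definition _ f :=
  GRing.isLinear.Build K (FA2 K) (FA2 K) *:%R (tmap f) (tmap_linear f).
HB.instance Definition _ :=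
  GRing.isLinear.Build K (FA2 K) (FA2 K) *:%R tau braid_linear.

Lemma tmap_braidU f (p q u v : word) :
  (tmap f (tau << (p, q) >>))@_(v, u) =
  chi p q * ((word_img f p)@_u * (word_img f q)@_v).
Proof.
rewrite (braidU p q) linearZ mcoeffZ /= (tmapU f q p).
by rewrite (mcoeff_tens (word_img f q)) [X in _ * X]mulrC.
Qed.

Lemma braid_tmapU f (p q u v : word) :
  (tau (tmap f << (p, q) >>))@_(v, u) =
  chi u v * ((word_img f p)@_u * (word_img f q)@_v).
Proof.
by rewrite (tmapU f p q) (mcoeff_braid (tens _ _) u v) mcoeff_tens mulrC.
Qed.

(** On the basis element [(p, q)], the coefficients of the two sides at [(v, u)] are one product of
    coefficients, multiplied by [chi p q] and by [chi u v] respectively. These factors must agree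
    exactly where the product is nonzero. *)
Lemma AutTP f : AutT q11 q12 q21 q22 f <-> is_aut f /\ braided f.
Proof.
split=> -[autf bf]; (split; first exact: autf).
  move=> k l u v uk vl.
  have := etrans (esym (tmap_braidU f (fmu k) (fmu l) u v)) (etrans
    (congr1 (mcoeff (v, u)) (bf << (fmu k, fmu l) >>))
    (braid_tmapU f (fmu k) (fmu l) u v)).
  rewrite !word_imgU => /mulIf -> //.
  by rewrite mulf_neq0 ?mcoeff_neq0.
apply: (@eq_linear_malg _ _ _ (tmap f \o tau) (tau \o tmap f)) => -[p q].
apply/malgP => -[v u].
apply: etrans (tmap_braidU f p q u v) (etrans _ (esym (braid_tmapU f p q u v))).
have [up|/mcoeff_outdom ->] := boolP (u \in msupp (word_img f p));
  last by rewrite mul0r !mulr0.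
have [vq|/mcoeff_outdom ->] := boolP (v \in msupp (word_img f q));
  last by rewrite !mulr0.
by rewrite (braided_words bf up vq).
Qed.
End Braiding.

(** * Pairs of words and leading words *)

Section WordPairs.
Variable T : eqType.
Implicit Types (u v : seq T) (s t : seq bool).

(** The morphism from the free monoid on [true] and [false] that sends them to [u] and [v]. *)
Definition bsub u v s : seq T := flatten [seq if b then u else v | b <- s].

Definition common_root u v :=
  exists w m n, u = flatten (nseq m w) /\ v = flatten (nseq n w).

Lemma common_rootC u v : common_root u v -> common_root v u.
Proof. by case=> w [m] [n] [-> ->]; exists w, n, m. Qed.

Lemma common_root0 v : common_root [::] v.
Proof. by exists v, 0%N, 1%N; rewrite /= cats0. Qed.

Lemma bsubC u v s : bsub u v s = bsub v u (map negb s).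
Proof. by rewrite /bsub -map_comp; congr flatten; apply: eq_map => -[]. Qed.

(* Substituting v u for u amounts to substituting in the letters first, which
   makes the Euclidean descent of [bsub_heads] possible. *)
Lemma bsub_cat u v s : bsub (v ++ u) v s =
  bsub u v (flatten [seq if b then [:: false; true] else [:: false] | b <- s]).
Proof.
elim: s => //= b s IH; rewrite /bsub /= -/(bsub _ _ _) IH.
by case: b; rewrite /= -?catA.
Qed.

Lemma common_root_cat u v : common_root u v -> common_root (v ++ u) v.
Proof.
by case=> w [m] [n] [-> ->]; exists w, (n + m)%N, n; rewrite nseqD flatten_cat.
Qed.

(** Any relation whose sides begin with different generators forces a common root. Euclidean descent
    on the total size: the shorter word is a prefix of the longer one, say [u = v ++ u'], and
    cancelling [v] leaves a relation of the same kind between [u'] and [v]. *)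
Lemma bsub_heads u v s t :
  u ++ bsub u v s = v ++ bsub u v t -> common_root u v.
Proof.
have [n] := ubnP (size u + size v); elim: n u v s t => // n IH u v s t.
wlog le_vu : u v s t / (size v <= size u)%N => [WL|] lt_n.
  case: (leqP (size v) (size u)) => [/WL|/ltnW le_uv e]; first exact.
  apply/common_rootC/(WL _ _ (map negb t) (map negb s)) => //.
    by rewrite addnC.
  by rewrite -!bsubC.
have [v0 _|vn0] := altP (v =P [::]).
  by apply: common_rootC; rewrite v0; apply: common_root0.
move=> e; have := congr1 (take (size v)) e.
rewrite takel_cat // take_size_cat // => take_u.
move: e lt_n; rewrite -(cat_take_drop (size v) u) take_u.
move: (drop _ u) => u' e; rewrite size_cat => lt_n.
apply: common_root_cat; move: e; rewrite -catA => /eqP.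
rewrite eqseq_cat // eqxx /= => /eqP; rewrite !bsub_cat.
have sv : (0 < size v)%N by rewrite lt0n size_eq0.
(* If [t] is empty, so is [u']. Otherwise the rewritten binary word starts with [false], whatever
   [b] is, so that [v] heads the right-hand side again. *)
case: t => [|b t] /=.
  by case: u' lt_n => // _ _; apply: common_root0.
have bsubF r : bsub u' v (false :: r) = v ++ bsub u' v r by [].
by case: b => /=; rewrite bsubF => e; apply: (IH u' v) e; lia.
Qed.

(** Common heads cancel, and the first difference between [s] and [t] contradicts [bsub_heads]. An
    empty [u] or [v] would have a common root with the other word. *)
Lemma bsub_inj u v s t :
  ~ common_root u v -> bsub u v s = bsub u v t -> s = t.
Proof.
move=> nuv; have nil0 b r : bsub u v (b :: r) <> [::].
  rewrite /bsub /= => /(congr1 size)/eqP; rewrite size_cat addn_eq0 => /andP[e _].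
  case: nuv; case: b e; rewrite size_eq0 => /eqP ->; first exact: common_root0.
  exact/common_rootC/common_root0.
elim: s t => [|b s IH] [|c t] //; first by move/esym/nil0.
  by move/nil0.
case: b c => [] [] e.
- by move/eqP: e; rewrite /bsub /= eqseq_cat // eqxx => /eqP /IH ->.
- by case: nuv; apply: bsub_heads e.
- by case: nuv; apply: bsub_heads (esym e).
- by move/eqP: e; rewrite /bsub /= eqseq_cat // eqxx => /eqP /IH ->.
Qed.

Lemma bsub_singleton u v s x : bsub u v s = [:: x] -> u = [:: x] \/ v = [:: x].
Proof.
elim: s => [//|b s IH]; rewrite /bsub /= -/(bsub u v s).
have cons_nil (y : T) r r' : y :: r ++ r' = [:: x] -> y :: r = [:: x].
  by case: r => [|z r] /= [->].
case: b => /=.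
  by case: u IH => [|y r] IH; [exact: IH|move=> /cons_nil; left].
by case: v IH => [|y r] IH; [exact: IH|move=> /cons_nil; right].
Qed.
End WordPairs.

Section SeqMax.
Import Order.TTheory.

Lemma seq_argmax (T : eqType) (d : Order.disp_t) (O : orderType d) (key : T -> O)
    (s : seq T) (x0 : T) : x0 \in s ->
  exists2 x, x \in s & {in s, forall y, key y <= key x}%O.
Proof.
elim: s x0 => // x s IH x0 _.
case: s IH => [_|x1 s /(_ x1 (mem_head _ _))[y ys ymax]].
  by exists x => [|y]; rewrite !inE // => /eqP ->.
have [le_yx|lt_xy] := leP (key y) (key x).
  exists x => [|z]; rewrite inE ?eqxx // => /predU1P[-> //|/ymax].
  by move=> /le_trans; apply.
exists y => [|z]; rewrite inE ?ys ?orbT // => /predU1P[-> |/ymax //].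
exact: ltW.
Qed.
End SeqMax.

(** * Weighted orders on words and leading words of elements *)

Section WordOrder.
Import Order.TTheory Num.Theory.
Variable c : 'I_2 -> int.
Implicit Types (u v w z : word) (i : 'I_2).

Definition wt u : int := \sum_(i <- (u : seq 'I_2)) c i.

(* Comparing sizes before letters makes the order compatible with concatenation
   on the right. *)
Definition word_key u : seqlexi int :=
  wt u :: (size u)%:Z :: [seq (nat_of_ord i)%:Z | i <- u].

Lemma wtM u v : wt (mmul u v) = wt u + wt v.
Proof. by rewrite /wt fmM big_cat. Qed.

Lemma wtU i : wt (fmu i) = c i.
Proof. by rewrite /wt fmU big_seq1. Qed.

Lemma word_key_inj : injective word_key.
Proof.
move=> u v [_ _ /inj_map e]; apply: word_inj; apply: e => i j [] /val_inj //.
Qed.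

(** Equal sizes place the first difference inside [s] and [t]; if [s] were a proper prefix of [t],
    appending [r] could reverse the order. *)
Lemma ltxi_catr (s t r : seqlexi int) :
  size s = size t -> (s < t)%O ->
  ((s ++ r : seqlexi int) < (t ++ r : seqlexi int))%O.
Proof.
elim: s t => [|x s IH] [|y t] //= [] e; rewrite !ltxi_cons => /andP[-> /=].
by move=> /implyP lt; apply/implyP => /lt; apply: IH.
Qed.

Lemma ltxi_catl (s t r : seqlexi int) :
  (s < t)%O -> ((r ++ s : seqlexi int) < (r ++ t : seqlexi int))%O.
Proof. by move=> lt; elim: r => //= x r IH; rewrite ltxi_cons lexx. Qed.

Lemma word_key_ltMr u v w :
  (word_key u < word_key v)%O -> (word_key (mmul u w) < word_key (mmul v w))%O.
Proof.
rewrite /word_key !ltxi_cons !wtM !fmM !size_cat !PoszD !map_cat.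
rewrite !lerD2r => /andP[-> /=] /implyP lt.
apply/implyP => /lt /andP[le1 /implyP lt1].
rewrite le1 /=; apply/implyP => le2; apply: ltxi_catr (lt1 le2).
by rewrite !size_map; apply/eqP; rewrite -eqz_nat eq_le le1 le2.
Qed.

Lemma word_key_ltMl u v w :
  (word_key u < word_key v)%O -> (word_key (mmul w u) < word_key (mmul w v))%O.
Proof.
rewrite /word_key !ltxi_cons !wtM !fmM !size_cat !PoszD !map_cat.
rewrite !lerD2l => /andP[-> /=] /implyP lt.
apply/implyP => /lt /andP[le1 /implyP lt1].
by rewrite le1 /=; apply/implyP => le2; apply: ltxi_catl (lt1 le2).
Qed.

Lemma word_key_leM u v u' v' :
  (word_key u' <= word_key u)%O -> (word_key v' <= word_key v)%O ->
  (word_key (mmul u' v') <= word_key (mmul u v))%O.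
Proof.
rewrite !le_eqVlt => /predU1P[/word_key_inj ->|ltu] /predU1P[/word_key_inj ->|ltv].
- by rewrite eqxx.
- by rewrite (word_key_ltMl _ ltv) orbT.
- by rewrite (word_key_ltMr _ ltu) orbT.
by rewrite (lt_trans (word_key_ltMl _ ltv) (word_key_ltMr _ ltu)) orbT.
Qed.

(** By strict monotonicity only the two leading words multiply to the leading word of a product,
    hence its coefficient cannot cancel. *)
Lemma word_key_eqM u v u' v' :
  (word_key u' <= word_key u)%O -> (word_key v' <= word_key v)%O ->
  mmul u' v' = mmul u v -> u' = u /\ v' = v.
Proof.
rewrite !le_eqVlt.
move=> /predU1P[/word_key_inj ->|ltu] /predU1P[/word_key_inj ->|ltv] //.
- by move=> e; have := word_key_ltMl u ltv; rewrite e ltxx.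
- by move=> e; have := word_key_ltMr v ltu; rewrite e ltxx.
move=> e; have := lt_trans (word_key_ltMl _ ltv) (word_key_ltMr _ ltu).
by rewrite e ltxx.
Qed.

Variable K : fieldType.
Implicit Types (p q : FA K) (f : endo_pair K).

Definition leading p u :=
  u \in msupp p /\ {in msupp p, forall z, word_key z <= word_key u}%O.

Lemma leading_exists p : p != 0 -> exists u, leading p u.
Proof.
rewrite -msupp_eq0 => /fset0Pn[z /(seq_argmax word_key)[u up umax]].
by exists u.
Qed.

Lemma leadingM p q u v : leading p u -> leading q v -> leading (p * q) (mmul u v).
Proof.
move=> [up umax] [vq vmax]; split; last first.
  by move=> z /msuppM_le[u' [v' [u'p v'q ->]]]; rewrite word_key_leM ?umax ?vmax.
rewrite -mcoeff_neq0 mcoeffMl (big_fsetD1 u) //= (big_fsetD1 v) //= eqxx mulr1n.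
rewrite big1_fset => [|v'].
  rewrite big1_fset => [|u']; last first.
    rewrite !inE => /andP[nu u'p] _; rewrite big1_fset // => v' v'q _.
    case: eqP => // /(word_key_eqM (umax _ u'p) (vmax _ v'q))[e _].
    by rewrite e eqxx in nu.
  by rewrite !addr0 mulf_neq0 ?mcoeff_neq0.
rewrite !inE => /andP[nv v'q] _; case: eqP => //.
move=> /(word_key_eqM (lexx _) (vmax _ v'q))[_ e].
by rewrite e eqxx in nv.
Qed.

Lemma leading1 : leading 1 mone.
Proof.
split; first by rewrite (msuppU1 K) inE.
by move=> z; rewrite (msuppU1 K) inE => /eqP ->.
Qed.

Definition wsub u v w : word :=
  FMonom (bsub u v [seq i == ord0 | i <- (w : seq 'I_2)]).

Lemma leading_word_img f u v w :
  leading f.1 u -> leading f.2 v -> leading (word_img f w) (wsub u v w).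
Proof.
move=> lu lv; elim/word_rect: w => [|i w IH].
  by rewrite word_img_mone /wsub fm1 /= -fmoneE; apply: leading1.
rewrite word_imgM word_imgU.
have -> : wsub u v (mmul (fmu i) w) = mmul (if i == ord0 then u else v) (wsub u v w).
  by apply: word_inj; rewrite [RHS]fmM /wsub [in LHS]fmM fmU /=; case: (i == ord0).
by apply: leadingM => //; rewrite /img; case: (i == ord0).
Qed.

(** By [bsub_inj], distinct words of [p] have images with distinct leading words, so the largest of
    these survives in [endo f p]. *)
Lemma leading_free f u v p :
  leading f.1 u -> leading f.2 v -> ~ common_root u v -> p != 0 ->
  exists w, wsub u v w \in msupp (endo f p).
Proof.
move=> lu lv nuv; rewrite -msupp_eq0 => /fset0Pn[z].
case/(seq_argmax (word_key \o wsub u v)) => w wp wmax.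
exists w; rewrite -mcoeff_neq0 /endo raddf_sum /= (big_fsetD1 w) //=.
rewrite big1_fset => [|w'].
  rewrite addr0 mcoeffZ mulf_neq0 ?mcoeff_neq0 //.
  by have [] := leading_word_img w lu lv.
rewrite !inE => /andP[nw w'p] _; rewrite mcoeffZ.
rewrite [X in _ * X]mcoeff_outdom ?mulr0 //.
apply/negP => /(leading_word_img w' lu lv).2 le_w.
have /word_key_inj [] : word_key (wsub u v w) = word_key (wsub u v w').
  by apply/eqP; rewrite eq_le le_w; apply: wmax.
move=> /(bsub_inj nuv)/inj_map e; case/negP: nw; apply/eqP/word_inj/esym.
by apply: e => i j; case: (ord2E i) => ->; case: (ord2E j) => ->.
Qed.

Lemma aut_neq0 f i : is_aut f -> img f i != 0.
Proof.
move=> /bij_inj inj; rewrite -endoX -(linear0 (endo f)) (inj_eq inj).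
by rewrite monalgU_eq0 oner_eq0.
Qed.

(** Writing [x_i] as the image under [f] of some element, [leading_free] yields a product of copies
    of [u] and [v] equal to a single letter; one of its factors must be that letter. *)
Lemma aut_leading f u v : is_aut f ->
  leading f.1 u -> leading f.2 v -> ~ common_root u v ->
  forall i, u = fmu i \/ v = fmu i.
Proof.
move=> autf lu lv nuv i; have [g _ gK] := autf.
have e := gK (X K i); have [|w] := leading_free (p := g (X K i)) lu lv nuv.
  apply: contraTneq isT => g0; move: e; rewrite g0 linear0 => /esym/eqP.
  by rewrite monalgU_eq0 oner_eq0.
rewrite e (msuppU1 K) inE => /word_eqP; rewrite fmU /=.
by case/bsub_singleton => h; [left|right]; apply: word_inj; rewrite fmU.
Qed.
End WordOrder.

(** * Automorphisms with words of extremal weight *)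

Section Extremal.
Import Order.TTheory Num.Theory.
Variable K : fieldType.
Implicit Types (f : endo_pair K) (p : FA K) (u v w z : word) (i j k l : 'I_2).

Lemma ord2_cases i k : k = i \/ k = rev_ord i.
Proof.
by case: (ord2E i) => ->; case: (ord2E k) => ->; [left|right|right|left];
  apply: val_inj.
Qed.

Lemma rev_ord2_neq i : rev_ord i == i = false.
Proof. by case: (ord2E i) => ->. Qed.

Lemma size_occ i w : size w = (occ w i + occ w (rev_ord i))%N.
Proof.
elim/word_rect: w => [|k w IH]; first by rewrite !occ1 fm1.
rewrite !occM !occU fmM fmU /= IH.
case: (ord2_cases i k) => ->; rewrite eqxx.
  by rewrite eq_sym rev_ord2_neq; lia.
by rewrite rev_ord2_neq; lia.
Qed.

Lemma wt_occ (c : 'I_2 -> int) i w :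
  wt c w = c i * (occ w i)%:Z + c (rev_ord i) * (occ w (rev_ord i))%:Z.
Proof.
elim/word_rect: w => [|k w IH]; first by rewrite /wt !occ1 fm1 big_nil !mulr0.
rewrite wtM wtU IH !occM !occU !PoszD !mulrDr.
by case: (ord2_cases i k) => ->; rewrite eqxx ?[i == _]eq_sym rev_ord2_neq /=; ring.
Qed.

Lemma wt_root (c : 'I_2 -> int) u w m :
  u = flatten (nseq m (w : seq 'I_2)) :> seq _ -> wt c u = wt c w * m%:Z.
Proof.
rewrite /wt => ->; elim: m => [|m IH]; first by rewrite big_nil mulr0.
by rewrite /= big_cat /= IH intS mulrDr mulr1.
Qed.

Lemma word_key_le c u v : (word_key c u <= word_key c v)%O ->
  (wt c u <= wt c v) /\ (wt c u = wt c v -> (size u <= size v)%N).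
Proof.
rewrite /word_key lexi_cons => /andP[le1 /implyP le2]; split=> // e.
by have := le2 _; rewrite e lexx lexi_cons => /(_ isT) /andP[].
Qed.

Lemma aut_leading_img c f i u v : is_aut f ->
  leading c (img f i) u -> leading c (img f (rev_ord i)) v -> ~ common_root u v ->
  forall k, u = fmu k \/ v = fmu k.
Proof.
have r0 : rev_ord ord0 = ord_max :> 'I_2 by apply: val_inj.
have r1 : rev_ord ord_max = ord0 :> 'I_2 by apply: val_inj.
case: (ord2E i) => ->; rewrite ?r0 ?r1 /img /= => autf lu lv nuv k.
  exact: (aut_leading autf lu lv nuv).
have [] := aut_leading autf lv lu _ k; [|by right|by left].
by move/common_rootC.
Qed.

(* [rev_ord] exchanges the two letters. *)
Lemma wt_extreme (c : 'I_2 -> int) f i (j := rev_ord i) : is_aut f ->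
  fmu i \in msupp (img f i) -> fmu j \in msupp (img f j) ->
  c j <= 0 <= c i -> c j < c i ->
  {in msupp (img f i), forall z, wt c z <= c i} ->
  {in msupp (img f j), forall z, wt c z <= c j} ->
  {in msupp (img f i), forall z, wt c z = c i -> (size z <= 1)%N} /\
  {in msupp (img f j), forall z, wt c z = c j -> (size z <= 1)%N}.
Proof.
move=> autf xi xj /andP[cj0 ci0] cji wi wj.
have [u lu] := leading_exists c (aut_neq0 i autf).
have [v lv] := leading_exists c (aut_neq0 j autf).
have [iu su] := word_key_le (lu.2 _ xi); have [jv sv] := word_key_le (lv.2 _ xj).
rewrite !wtU in iu su jv sv.
have wu : wt c u = c i by apply/le_anti; rewrite wi ?lu.1.
have wv : wt c v = c j by apply/le_anti; rewrite wj ?lv.1.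
(* A root of weight [x] gives [c i = x * m] and [c j = x * n]. Here [m, n > 0], because [u] and [v]
   are at least as long as a letter of the same weight. So [c i] and [c j] have the sign of [x]; as
   [c j <= 0 <= c i], both vanish, against [c j < c i]. *)
have nuv : ~ common_root u v.
  case=> s [m] [n] [um vn]; have := wt_root (w := FMonom s) c um.
  have := wt_root (w := FMonom s) c vn.
  have : (0 < size u)%N by have := su (esym wu); rewrite fmU.
  have : (0 < size v)%N by have := sv (esym wv); rewrite fmU.
  rewrite um vn wu wv; case: m {um} => // m; case: n {vn} => // n _ _.
  by move: (wt c _) => x; nia.
have luv := aut_leading_img autf lu lv nuv.
have ui : u = fmu i.
  by case: (luv i) => // e; move: wv cji; rewrite e wtU => ->; rewrite ltxx.
have vj : v = fmu j.
  by case: (luv j) => // e; move: wu cji; rewrite e wtU => ->; rewrite ltxx.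
split=> z zf wz.
  by have [_] := word_key_le (lu.2 _ zf); rewrite wz wu ui fmU; apply.
by have [_] := word_key_le (lv.2 _ zf); rewrite wz wv vj fmU; apply.
Qed.

Lemma fmu_mul k u v : mmul u v = fmu k -> u = fmu k \/ v = fmu k.
Proof.
move/(congr1 (@fmonom_val _)); rewrite fmM fmU.
case eu: (u : seq _) => [|a s] /= e.
  by right; apply: word_inj; rewrite fmU.
left; apply: word_inj; rewrite eu fmU; case: e => ->.
by case: s {eu}.
Qed.

(** By surjectivity [x_k] occurs in the image of some word, which is a product of components of [f].
    A letter factors only trivially, hence it occurs already in one component. *)
Lemma aut_linear_part f k : is_aut f -> exists l, fmu k \in msupp (img f l).
Proof.
case=> g _ gK; have := gK (X K k); move: (g _) => p e.
have : fmu k \in msupp (endo f p) by rewrite e (msuppU1 K) inE.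
have [/hasP[w _]|/hasPn no] :=
    boolP (has (fun w => fmu k \in msupp (word_img f w)) (msupp p)).
  move=> + _; elim/word_rect: w => [|l w IH].
    by rewrite word_img_mone (msuppU1 K) inE => /word_eqP; rewrite fmU fm1.
  rewrite word_imgM word_imgU => /msuppM_le[u1 [u2 [u1l u2w /esym/fmu_mul[] h]]].
    by exists l; rewrite -h.
  by apply: IH; rewrite -h.
rewrite -mcoeff_neq0 /endo raddf_sum /= big_seq big1 ?eqxx // => w wp.
by rewrite mcoeffZ [X in _ * X]mcoeff_outdom ?mulr0 //; apply: no.
Qed.

Lemma fmu_of_occ i z : size z = 1%N -> occ z i = 1%N -> z = fmu i.
Proof.
case: z => [[|a [|//]]] //= _; rewrite /occ /= => e; apply: word_inj; rewrite fmU /=.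
by case: eqP e => [->|].
Qed.

(** * Automorphisms with one component even and the other odd in a letter *)

Section EvenOdd.
Variables (f : endo_pair K) (i : 'I_2).
Let j := rev_ord i.
Hypotheses (autf : is_aut f)
  (evenf : {in msupp (img f i), forall z, ~~ odd (occ z j)})
  (oddf : {in msupp (img f j), forall z, odd (occ z j)}).

(** Each letter occurs in some component, and the parity in [x_j] excludes the wrong one. *)
Lemma even_odd_linear : fmu i \in msupp (img f i) /\ fmu j \in msupp (img f j).
Proof.
split.
  have [l] := aut_linear_part i autf; case: (ord2_cases i l) => -> //.
  by move/oddf; rewrite occU eq_sym rev_ord2_neq.
have [l] := aut_linear_part j autf; case: (ord2_cases i l) => -> //.
by move/evenf; rewrite occU eqxx.
Qed.

(** The starting position of the tilting, with weights 0 and -1. Oddness gives every word of [f_j]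
    an occurrence of [x_j], hence weight at most -1. *)
Lemma even_odd_small :
  {in msupp (img f i), forall z, occ z j = 0%N -> (size z <= 1)%N} /\
  {in msupp (img f j), forall z, occ z j = 1%N -> (size z <= 1)%N}.
Proof.
have [xi xj] := even_odd_linear.
pose c k : int := if k == i then 0 else -1.
have ci : c i = 0 by rewrite /c eqxx.
have cj : c j = -1 by rewrite /c rev_ord2_neq.
have wtc z : wt c z = - (occ z j)%:Z.
  by rewrite (wt_occ c i) -/j ci cj mul0r add0r mulN1r.
have [] := @wt_extreme c f i autf xi xj.
- by rewrite -/j ci cj.
- by rewrite -/j ci cj.
- by move=> z _; rewrite wtc ci; lia.
- by move=> z /oddf; rewrite wtc -/j cj; case: (occ z j) => // n _; lia.
rewrite -/j ci cj => si sj; split=> z zf e; [apply: si|apply: sj] => //;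
  by rewrite wtc e.
Qed.

Lemma even_odd_support :
  {in msupp (img f i), forall z, occ z i = 0%N \/ z = fmu i} /\
  {in msupp (img f j), forall z, z = fmu j}.
Proof.
have [xi xj] := even_odd_linear; have [si sj] := even_odd_small.
pose bad1 z := (0 < occ z i)%N && (0 < occ z j)%N.
pose bad2 z := (1 < occ z j)%N.
(* B lists the slopes, as fractions M / N, at which a word of f becomes as heavy
   as the corresponding letter for the weights N of x_i and - M of x_j. *)
pose B := [seq ((occ z i).-1, occ z j) | z <- [seq z <- msupp (img f i) | bad1 z]]
  ++ [seq (occ z i, (occ z j).-1) | z <- [seq z <- msupp (img f j) | bad2 z]].
have sz z : size z = (occ z i + occ z j)%N := size_occ i z.
(* Without bad words, [si], [sj] and oddness leave only the allowed words. *)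
have [B0|] := eqVneq B [::].
  have B1 z : z \in msupp (img f i) -> ~~ bad1 z.
    move=> zf; apply/negP => bz.
    suff : ((occ z i).-1, occ z j) \in B by rewrite B0.
    by rewrite mem_cat; apply/orP; left; apply: map_f; rewrite mem_filter bz.
  have B2 z : z \in msupp (img f j) -> ~~ bad2 z.
    move=> zf; apply/negP => bz.
    suff : (occ z i, (occ z j).-1) \in B by rewrite B0.
    by rewrite mem_cat; apply/orP; right; apply: map_f; rewrite mem_filter bz.
  split=> z zf.
    move: (B1 z zf) (si z zf) (fmu_of_occ (i := i) (z := z)); rewrite sz /bad1.
    case: (occ z j) => [|n]; case: (occ z i) => [|m] //=; try by left.
    by move=> _ /(_ erefl); rewrite addn0 ltnS leqn0 => /eqP -> h; right; apply: h.
  move: (B2 z zf) (sj z zf) (oddf zf) (fmu_of_occ (i := j) (z := z)).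
  rewrite sz /bad2; case: (occ z j) => [|[|n]] // _ /(_ erefl).
  by rewrite addn1 ltnS leqn0 => /eqP -> _; apply.
case eB : B => [//|b B'] _.
(* Tilting lowers the ratio [M / N] from infinity, so the first word to be reached is one of largest
   slope. *)
have [] := seq_argmax (fun MN : nat * nat => MN.1%:Q / MN.2%:Q) (_ : b \in B).
  by rewrite eB mem_head.
have Bpos MN : MN \in B -> (0 < MN.2)%N.
  rewrite mem_cat => /orP[] /mapP[z]; rewrite mem_filter => /andP[bz _] -> /=.
    by case/andP: bz.
  by rewrite -ltnS prednK // ltnW.
move=> [M N] MNB Bmax; have /= N0 := Bpos _ MNB.
have {}Bmax M' N' : (M', N') \in B -> (M' * N <= M * N')%N.
  move=> h; have /= N'0 := Bpos _ h; have /= := Bmax _ h.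
  rewrite ler_pdivrMr ?ltr0n // mulrAC ler_pdivlMr ?ltr0n //.
  by rewrite -!natrM ler_nat.
pose c k : int := if k == i then N%:Z else - M%:Z.
have ci : c i = N by rewrite /c eqxx.
have cj : c j = - M%:Z by rewrite /c rev_ord2_neq.
have wtc z : wt c z = N%:Z * (occ z i)%:Z - M%:Z * (occ z j)%:Z.
  by rewrite (wt_occ c i) -/j ci cj mulNr.
have [] := @wt_extreme c f i autf xi xj.
- by rewrite -/j ci cj; lia.
- by rewrite -/j ci cj; lia.
(* For a bad word the weight bound is maximality of the slope, cross-multiplied; for the others it
   follows from [si]. *)
- move=> z zf; rewrite wtc ci; have [bz|] := boolP (bad1 z).
    have : ((occ z i).-1, occ z j) \in B.
      by rewrite mem_cat; apply/orP; left; apply: map_f; rewrite mem_filter bz.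
    by move/Bmax; case/andP: bz; nia.
  move: (si z zf); rewrite sz /bad1; case: (occ z i) => [|m]; first by nia.
  by case: (occ z j) => //= /(_ erefl); nia.
- move=> z zf; rewrite wtc -/j cj; have [bz|] := boolP (bad2 z).
    have : (occ z i, (occ z j).-1) \in B.
      by rewrite mem_cat; apply/orP; right; apply: map_f; rewrite mem_filter bz.
    by move/Bmax; move: bz; rewrite /bad2; nia.
  move: (sj z zf) (oddf zf); rewrite sz /bad2; case: (occ z j) => [|[|n]] //=.
  by move=> /(_ erefl); nia.
(* A word of slope [M / N] is exactly as heavy as the corresponding letter but has size at least 2,
   which [wt_extreme] forbids. *)
rewrite -/j ci cj => ei ej; exfalso; move: MNB.
rewrite mem_cat => /orP[] /mapP[z]; rewrite mem_filter => /andP[bz zf] [eM eN].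
  have /ei : z \in msupp (img f i) by [].
  by rewrite wtc sz eM eN; case/andP: bz; nia.
have /ej : z \in msupp (img f j) by [].
by rewrite wtc sz eM eN; move: bz; rewrite /bad2; nia.
Qed.
End EvenOdd.
End Extremal.

(** * Triangular and monomial automorphisms *)

Section Forms.
Variable K : fieldType.
Implicit Types (f : endo_pair K) (p : FA K) (u v w z : word) (i j k l : 'I_2).

Lemma supp_single p w : {in msupp p, forall z, z = w} -> p = p@_w *: << w >>.
Proof.
move=> sp; apply/malgP => z; rewrite mcoeffZ mcoeffU.
have [<-|nwz] := eqVneq w z; first by rewrite mulr1.
rewrite mulr0 mcoeff_outdom //; apply/negP => /sp e.
by rewrite e eqxx in nwz.
Qed.

Lemma XnE i n : X K i ^+ n = << FMonom (nseq n i) >>.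
Proof.
elim: n => [|n IH]; first by rewrite expr0 -fmoneE.
rewrite exprS IH malgU_mul; congr << _ >>.
by apply: word_inj; rewrite fmM fmU.
Qed.

Definition poly_sq i (g : {poly K}) : FA K :=
  \sum_(n < size g) g`_n *: (X K i ^+ (2 * n)).

Lemma endo_sum_sq f (g : {poly K}) p :
  endo f (\sum_(n < size g) g`_n *: (p ^+ (2 * n))) =
  \sum_(n < size g) g`_n *: (endo f p ^+ (2 * n)).
Proof.
rewrite linear_sum; apply: eq_bigr => n _.
by rewrite linearZ /= rmorphXn.
Qed.

Lemma endo_poly_sq f i g :
  endo f (poly_sq i g) = \sum_(n < size g) g`_n *: (img f i ^+ (2 * n)).
Proof. by rewrite -endoX; apply: endo_sum_sq. Qed.

Lemma poly_sq_widen i (g : {poly K}) n : (size g <= n)%N ->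
  poly_sq i g = \sum_(m < n) g`_m *: (X K i ^+ (2 * m)).
Proof.
move=> le; rewrite /poly_sq.
rewrite (big_ord_widen n (fun m => g`_m *: (X K i ^+ (2 * m)))) //.
rewrite big_mkcond; apply: eq_bigr => m _; case: ltnP => // le_m.
by rewrite nth_default ?scale0r.
Qed.

Lemma occ0_word i z : occ z i = 0%N ->
  z = FMonom (nseq (occ z (rev_ord i)) (rev_ord i)).
Proof.
move=> z0; apply: word_inj => /=.
have -> : occ z (rev_ord i) = size z by rewrite (size_occ i) z0.
apply/all_pred1P/allP => k kz; apply/eqP; case: (ord2_cases i k) => // e.
move/eqP: z0; rewrite -leqn0 leqNgt -has_count => /hasPn /(_ _ kz).
by rewrite /= e eqxx.
Qed.

(** This is [G4] for [i = ord0], and its conjugate by the exchange of letters for [i = ord_max]. *)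
Definition triangular i f := exists (a b : K) (g : {poly K}),
  [/\ a != 0, b != 0, img f i = a *: X K i + poly_sq (rev_ord i) g
    & img f (rev_ord i) = b *: X K (rev_ord i)].

Definition even_odd i f :=
  {in msupp (img f i), forall z, ~~ odd (occ z (rev_ord i))} /\
  {in msupp (img f (rev_ord i)), forall z, odd (occ z (rev_ord i))}.

Lemma even_odd_triangular i f : is_aut f -> even_odd i f -> triangular i f.
Proof.
move=> autf [evenf oddf]; set j := rev_ord i in evenf oddf *.
have [xi xj] := even_odd_linear autf evenf oddf.
have [si sj] := even_odd_support autf evenf oddf.
(* The bound [n] exceeds the size of every word of [p], so that [g] collects the coefficients of all
   even powers of [x_j]. *)
pose p := img f i; pose n := (\max_(z <- msupp p) size z).+1.
pose xx m : word := FMonom (nseq (2 * m) j).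
pose g := \poly_(m < n) p@_(xx m).
exists p@_(fmu i), (img f j)@_(fmu j), g.
rewrite !mcoeff_neq0; split=> //; last exact: supp_single.
rewrite (poly_sq_widen j (size_poly _ _)); apply/malgP => z.
rewrite mcoeffD mcoeffZ mcoeffU raddf_sum /=.
under eq_bigr => m _ do rewrite XnE mcoeffZ mcoeffU coef_poly ltn_ord -/(xx m).
have [<-|nz] := eqVneq (fmu i) z.
  rewrite mulr1 big1 ?addr0 // => m _; case: eqP => [e|_]; last by rewrite mulr0.
  have := congr1 (occ^~ i) e; rewrite occU eqxx /occ /= => h.
  have : has (pred1 i) (nseq (2 * m) j) by rewrite has_count h.
  by rewrite has_nseq /= rev_ord2_neq andbF.
rewrite mulr0 add0r; have [zp|zp] := boolP (z \in msupp p); last first.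
  rewrite mcoeff_outdom // big1 // => m _.
  case: eqP => [->|_]; last by rewrite mulr0.
  by rewrite mcoeff_outdom ?mul0r.
have ez : z = xx (occ z j)./2.
  case: (si _ zp) => [z0|e]; last by rewrite e eqxx in nz.
  by rewrite {1}(occ0_word z0) /xx mul2n even_halfK ?evenf.
have lt_n : ((occ z j)./2 < n)%N.
  rewrite ltnS; apply: leq_trans (leq_bigmax_seq _ zp _) => //.
  by rewrite (size_occ i) -/j; lia.
rewrite (bigD1 (Ordinal lt_n)) //= -ez eqxx mulr1 big1 ?addr0 // => m nm.
case: eqP => [e|_]; last by rewrite mulr0.
case/negP: nm; apply/eqP/val_inj => /=.
have := congr1 (occ^~ j) e; rewrite /occ /= => <-.
by rewrite count_nseq /= eqxx mul1n mul2n doubleK.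
Qed.

Lemma triangular_even_odd i f : triangular i f -> even_odd i f.
Proof.
case=> a [b] [g] [_ _ fi fj]; split=> z; last first.
  rewrite fj => /(fsubsetP (msuppZ_le _ _)); rewrite (msuppU1 K) inE => /eqP ->.
  by rewrite occU eqxx.
rewrite fi => /(fsubsetP (msuppD_le _ _)); rewrite inE => /orP[].
  move/(fsubsetP (msuppZ_le _ _)); rewrite (msuppU1 K) inE => /eqP ->.
  by rewrite occU eq_sym rev_ord2_neq.
rewrite -mcoeff_neq0 raddf_sum /=; apply: contraR; rewrite negbK => oz.
rewrite big1 // => n _; rewrite XnE mcoeffZ mcoeffU.
case: eqP => [e|_]; last exact: mulr0.
by move: oz; rewrite -e /occ /= count_nseq /= eqxx mul1n mul2n odd_double.
Qed.

Definition pair_at i (a b : FA K) : endo_pair K :=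
  if i == ord0 then (a, b) else (b, a).

Lemma img_pair_at i a b :
  img (pair_at i a b) i = a /\ img (pair_at i a b) (rev_ord i) = b.
Proof. by case: (ord2E i) => ->. Qed.

Lemma ecomp_eidP f g i :
  endo f (img g i) = X K i -> endo f (img g (rev_ord i)) = X K (rev_ord i) ->
  ecomp f g = eid K.
Proof.
move=> e1 e2; apply: img_inj => k; rewrite img_ecomp img_eid.
by case: (ord2_cases i k) => ->.
Qed.

Lemma triangular_aut i f : triangular i f -> is_aut f.
Proof.
case=> a [b] [g] [a0 b0 fi fj]; set j := rev_ord i in fi fj *.
(* [G] is chosen so that [f] maps it to [poly_sq j g]; the inverse [h] subtracts it from [x_i]
   before rescaling. *)
pose G := \sum_(n < size g) g`_n *: ((b^-1 *: X K j) ^+ (2 * n)) : FA K.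
pose h := pair_at i (a^-1 *: (X K i - G)) (b^-1 *: X K j).
have [hi hj] : img h i = a^-1 *: (X K i - G) /\ img h j = b^-1 *: X K j.
  exact: img_pair_at.
have fh_j : endo f (b^-1 *: X K j) = X K j.
  by rewrite linearZ /= endoX fj scalerA mulVf ?scale1r.
have hf_j : endo h (b *: X K j) = X K j.
  by rewrite linearZ /= endoX hj scalerA mulfV ?scale1r.
apply: (@aut_cancel _ f h); apply: (ecomp_eidP (i := i)).
- rewrite hi linearZ /= linearB /= endoX fi.
  have -> : endo f G = poly_sq j g.
    exact: etrans (endo_sum_sq f g _)
      (congr1 (fun p : FA K => \sum_(n < size g) g`_n *: (p ^+ (2 * n))) fh_j).
  by rewrite addrK scalerA mulVf ?scale1r.
- by rewrite -/j hj; exact: fh_j.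
- rewrite fi linearD linearZ /= endoX hi endo_poly_sq hj -/G.
  by rewrite scalerA (mulfV a0) scale1r; exact: subrK.
- by rewrite -/j fj; exact: hf_j.
Qed.

(** * The exchange of the two letters and conjugation by it *)

Definition swap : endo_pair K := (x2 K, x1 K).

Lemma ecompA f g h : ecomp f (ecomp g h) = ecomp (ecomp f g) h.
Proof.
apply: img_inj => k; apply: etrans (img_ecomp f (ecomp g h) k) _.
apply: etrans (congr1 (endo f) (img_ecomp g h k)) _.
exact: etrans (esym (endo_ecomp f g _)) (esym (img_ecomp (ecomp f g) h k)).
Qed.

Lemma ecomp1l f : ecomp (eid K) f = f.
Proof. by apply: img_inj => k; rewrite !img_ecomp endo_eid. Qed.

Lemma ecomp1r f : ecomp f (eid K) = f.
Proof. by apply: img_inj => k; rewrite !img_ecomp img_eid endoX. Qed.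

Lemma img_swap k : img swap k = X K (rev_ord k).
Proof.
by case: (ord2E k) => ->; rewrite /img /=; congr (X K _); apply: val_inj.
Qed.

Lemma swapK : ecomp swap swap = eid K.
Proof.
apply: img_inj => k.
by rewrite (img_ecomp swap) img_swap endoX img_swap img_eid rev_ordK.
Qed.

Lemma swap_aut : is_aut swap.
Proof. exact: (aut_cancel swapK swapK). Qed.

Definition swap_conj f := ecomp swap (ecomp f swap).

Lemma swapKl f : ecomp swap (ecomp swap f) = f.
Proof.
apply: etrans (ecompA swap swap f) _.
by rewrite swapK; exact: ecomp1l.
Qed.

Lemma swap_conjM f g : swap_conj (ecomp f g) = ecomp (swap_conj f) (swap_conj g).
Proof.
apply/esym; apply: etrans (esym (ecompA swap (ecomp f swap) (swap_conj g))) _.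
apply: (congr1 (ecomp swap)); apply: etrans (esym (ecompA f swap (swap_conj g))) _.
exact: etrans (congr1 (ecomp f) (swapKl _)) (ecompA f g swap).
Qed.

Lemma swap_conjK f : swap_conj (swap_conj f) = f.
Proof.
apply: etrans (congr1 (ecomp swap) (esym (ecompA swap (ecomp f swap) swap))) _.
apply: etrans (swapKl _) _; apply: etrans (esym (ecompA f swap swap)) _.
exact: etrans (congr1 (ecomp f) swapK) (ecomp1r f).
Qed.

Lemma triangular_swap i f : triangular i f -> triangular (rev_ord i) (swap_conj f).
Proof.
have img_conj k : img (swap_conj f) k = endo swap (img f (rev_ord k)).
  by rewrite !img_ecomp img_swap endoX.
have swapX k : endo swap (X K k) = X K (rev_ord k) by rewrite endoX img_swap.
case=> a [b] [g] [a0 b0 fi fj]; exists a, b, g; split; [exact: a0|exact: b0| |].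
  rewrite img_conj rev_ordK fi linearD linearZ /= swapX endo_poly_sq.
  rewrite img_swap rev_ordK; reflexivity.
rewrite img_conj !rev_ordK fj linearZ /= swapX rev_ordK; reflexivity.
Qed.

Lemma triangular_G4 f : triangular ord0 f <-> G4 f.
Proof.
have r0 : rev_ord ord0 = ord_max :> 'I_2 by apply: val_inj.
split=> [[a [b [g [a0 b0 fi fj]]]]|[a [b [g [a0 b0 ->]]]]]; exists a, b, g.
  split; [exact: a0|exact: b0|]; rewrite r0 in fi fj.
  by move: fi fj; case: (f) => f1 f2; rewrite /img /= => -> ->.
by rewrite r0; split; [exact: a0|exact: b0| |].
Qed.

(** The index [i] encodes the permutation of the letters: trivial for [ord0], the exchange for
    [ord_max]. *)
Definition monomial i (a b : K) : endo_pair K := (a *: X K i, b *: X K (rev_ord i)).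

Lemma monomial_aut i a b : a != 0 -> b != 0 -> is_aut (monomial i a b).
Proof.
have r0 : rev_ord ord0 = ord_max :> 'I_2 by apply: val_inj.
have r1 : rev_ord ord_max = ord0 :> 'I_2 by apply: val_inj.
have aut0 c d : c != 0 -> d != 0 -> is_aut (monomial ord0 c d).
  move=> c0 d0; apply: (@triangular_aut ord0); exists c, d, 0.
  split; [exact: c0|exact: d0| |by []].
  by rewrite /poly_sq size_poly0 big_ord0 addr0.
move=> a0 b0; case: (ord2E i) => ->; first exact: aut0.
have -> : monomial ord_max a b = ecomp (monomial ord0 b a) swap.
  apply: img_inj => k; rewrite img_ecomp img_swap endoX.
  by case: (ord2E k) => ->; rewrite ?r0 ?r1 /img /monomial /= ?r0 ?r1.
exact: aut_comp (aut0 _ _ _ _) swap_aut.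
Qed.

(** With zero weights the order compares sizes first. Without common roots the leading words are the
    two letters, so that every word has size at most 1; the last two hypotheses then leave one
    letter in each component. *)
Lemma monomial_support f : is_aut f ->
  (forall u v, u \in msupp f.1 -> v \in msupp f.2 -> ~ common_root u v) ->
  (forall k, mone \notin msupp (img f k)) ->
  (forall k, ~ (fmu ord0 \in msupp (img f k) /\ fmu ord_max \in msupp (img f k))) ->
  exists i a b, [/\ a != 0, b != 0 & f = monomial i a b].
Proof.
move=> autf nroot no1 no2; pose c (_ : 'I_2) : int := 0.
have [u lu] := leading_exists c (aut_neq0 ord0 autf).
have [v lv] := leading_exists c (aut_neq0 ord_max autf).
have uv := aut_leading autf lu lv (nroot u v lu.1 lv.1).
have wt0 z : wt c z = 0 by apply: big1.
have size_le k w : leading c (img f k) w -> size w = 1%N ->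
    {in msupp (img f k), forall z, z = fmu ord0 \/ z = fmu ord_max}.
  move=> lw w1 z zf; have [_] := word_key_le (lw.2 _ zf).
  rewrite !wt0 w1 => /(_ erefl); have := no1 k; move: zf.
  case: z => [[|a [|//]]] zf.
    by case/negP; rewrite -[mone]/(fmone _) fmoneE.
  by move=> _ _; case: (ord2E a) => ->; [left|right]; apply: word_inj; rewrite fmU.
have single k w i : leading c (img f k) w -> w = fmu i ->
    (img f k)@_w != 0 /\ img f k = (img f k)@_w *: X K i.
  move=> lw wi; split; first by rewrite mcoeff_neq0 lw.1.
  rewrite {w}wi in lw *; apply: (@supp_single (img f k) (fmu i)) => z zf.
  have w1 : size (fmu i : word) = 1%N by rewrite fmU.
  have d := size_le k _ lw w1 z zf; have := lw.1; have := no2 k; move: zf.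
  by case: (ord2E i) d => -> [] -> // h1 h2 h3; case: h2.
have [i [ui vi]] : exists i, u = fmu i /\ v = fmu (rev_ord i).
  have neq k : fmu k <> fmu (rev_ord k) :> word.
    by move/(congr1 (occ^~ k)); rewrite !occU eqxx rev_ord2_neq.
  have [ui|vi] := uv ord0.
    by exists ord0; have [] := uv (rev_ord ord0) => // /(etrans (esym ui))/neq.
  exists (rev_ord ord0); rewrite rev_ordK; split=> //.
  by have [] := uv (rev_ord ord0) => // /(etrans (esym vi))/neq.
have [a0 fa] := single _ _ _ lu ui; have [b0 fb] := single _ _ _ lv vi.
exists i, (f.1@_u), (f.2@_v); split=> //.
by rewrite /monomial; move: fa fb; rewrite /img /= => <- <-; case: (f).
Qed.
End Forms.

(** * Automorphisms of involutive diagonal braidings *)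

Section InvolutiveBraiding.
Variables (K : fieldType) (q11 q12 q21 q22 : K).
Hypotheses (charK : 2%N \notin [pchar K])
  (hinv : [/\ q11 ^+ 2 = 1, q22 ^+ 2 = 1 & q12 * q21 = 1]).
Implicit Types (f : endo_pair K) (u v w z : word) (i k l : 'I_2).
Local Notation chi := (bcoef q11 q12 q21 q22).
Local Notation Aut := (AutT q11 q12 q21 q22).
Local Notation braidedq := (braided q11 q12 q21 q22).

Lemma opp1_neq1 : -1 != 1 :> K.
Proof.
apply: contra charK => /eqP e; rewrite inE /=.
have -> : 2%:R = 1 - -1 :> K by rewrite opprK.
by rewrite e subrr.
Qed.

Lemma sign_eq1 n : ((-1) ^+ n == 1 :> K) = ~~ odd n.
Proof. by rewrite -signr_odd; case: odd; rewrite ?eqxx ?(negbTE opp1_neq1). Qed.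

Lemma sign_eqN1 n : ((-1) ^+ n == -1 :> K) = odd n.
Proof.
by rewrite -signr_odd; case: odd; rewrite ?eqxx // expr0 eq_sym (negbTE opp1_neq1).
Qed.

Lemma bcoef_letters :
  [/\ chi (fmu ord0) (fmu ord0) = q11, chi (fmu ord0) (fmu ord_max) = q12,
      chi (fmu ord_max) (fmu ord0) = q21 & chi (fmu ord_max) (fmu ord_max) = q22].
Proof. by rewrite /bcoef !occU /= !expr0 !expr1 !mulr1 !mul1r. Qed.

(** In [chi w w] the exponents of [q12] and [q21] coincide, so these factors cancel and only powers
    of [q11] and [q22] remain. *)
Lemma bcoef_diag_sqr w : chi w w ^+ 2 = 1.
Proof.
case: hinv => h1 h2 h12; rewrite /bcoef.
move: (occ w ord0) (occ w ord_max) => s t.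
rewrite -(mulrA (q11 ^+ _)) [(t * s)%N]mulnC -exprMn h12 expr1n mulr1.
by rewrite exprMn exprAC h1 expr1n mul1r exprAC h2 expr1n.
Qed.

Lemma bcoef_rootl u w z m : u = flatten (nseq m (w : seq 'I_2)) :> seq _ ->
  chi u z = chi w z ^+ m.
Proof.
elim: m u => [|m IH] u /= e.
  by rewrite (_ : u = mone) ?bcoef1l //; apply: word_inj; rewrite e fm1.
rewrite exprS -(IH (FMonom (flatten (nseq m (w : seq 'I_2))))) // -bcoefMl.
by congr (chi _ z); apply: word_inj; rewrite e fmM.
Qed.

Lemma bcoef_rootr u w z m : u = flatten (nseq m (w : seq 'I_2)) :> seq _ ->
  chi z u = chi z w ^+ m.
Proof.
elim: m u => [|m IH] u /= e.
  by rewrite (_ : u = mone) ?bcoef1r //; apply: word_inj; rewrite e fm1.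
rewrite exprS -(IH (FMonom (flatten (nseq m (w : seq 'I_2))))) // -bcoefMr.
by congr (chi z _); apply: word_inj; rewrite e fmM.
Qed.

(** For a root [w] put [e = chi w w], which is 1 or -1. The exponents [m], [n] of [u], [v] give
    [q11 = e ^+ (m * m)], [q12 = e ^+ (m * n)] and [q22 = e ^+ (n * n)], and the parities of [m] and
    [n] decide. *)
Lemma braided_root f u v : braidedq f ->
  u \in msupp f.1 -> v \in msupp f.2 -> common_root u v ->
  (q11 = q12 /\ q22 = q12) \/ (q12 = 1 /\ (q11 = 1 \/ q22 = 1)).
Proof.
move=> bf uf vf [s [m [n [um vn]]]]; pose w : word := FMonom s.
have [e11 e12 _ e22] := bcoef_letters.
have := bf ord_max ord_max v v vf vf; have := bf ord0 ord_max u v uf vf.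
have := bf ord0 ord0 u u uf uf; rewrite e11 e12 e22.
rewrite !(bcoef_rootl (w := w) _ um) !(bcoef_rootl (w := w) _ vn).
rewrite !(bcoef_rootr (w := w) _ um) !(bcoef_rootr (w := w) _ vn).
have /eqP := bcoef_diag_sqr w; rewrite sqrf_eq1 => /orP[] /eqP -> <- <- <-.
  by left; rewrite !expr1n.
rewrite -!exprM -![(-1) ^+ (_ * _)]signr_odd !oddM.
case: (odd m); case: (odd n); rewrite /= ?expr0 ?expr1; [by left| | |by left].
  by right; split; [|right].
by right; split; [|left].
Qed.

(** Comparing the empty word with any word of the nonzero component [f_l] gives [chi x_k x_l = 1]
    for both [l]. For the second letter this is [q21 = 1], and involutivity gives [q12 = 1]. *)
Lemma braided_mone f k : is_aut f -> braidedq f -> mone \in msupp (img f k) ->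
  q12 = 1 /\ (q11 = 1 \/ q22 = 1).
Proof.
move=> autf bf k1; have [e11 e12 e21 e22] := bcoef_letters.
have sup l : chi (fmu k) (fmu l) = 1.
  have [z [zl _]] := leading_exists (fun=> 0) (aut_neq0 l autf).
  by rewrite -(bf k l mone z) // bcoef1l.
have := sup ord0; have := sup ord_max; case: (ord2E k) => ->.
  by rewrite e12 e11 => -> ->; split; [|left].
rewrite e21 e22 => -> q21_1; split; last by right.
by case: hinv => _ _; rewrite q21_1 mulr1.
Qed.

Lemma braided_letters f k : braidedq f ->
  fmu ord0 \in msupp (img f k) -> fmu ord_max \in msupp (img f k) ->
  q11 = q12 /\ q22 = q12.
Proof.
move=> bf x0 x1; have [e11 e12 e21 e22] := bcoef_letters.
have := bf k k _ _ x0 x0; have := bf k k _ _ x0 x1; have := bf k k _ _ x1 x1.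
rewrite e11 e12 e22; move: (chi _ _) => c e22' e12' e11'.
by rewrite e22' e12' e11'.
Qed.

(** A common root, a constant term, or two letters in one component would each force one of the two
    excluded patterns. *)
Lemma Aut_monomial f :
  ~ (q11 = q12 /\ q22 = q12) -> ~ (q12 = 1 /\ (q11 = 1 \/ q22 = 1)) -> Aut f ->
  exists i a b, [/\ a != 0, b != 0 & f = monomial i a b].
Proof.
move=> n1 n2 /AutTP[autf bf]; apply: monomial_support => // [u v uf vf|k|k].
- by case/(braided_root bf uf vf).
- by apply/negP => /(braided_mone autf bf).
- by case=> x0 x1; apply/n1/(braided_letters bf x0 x1).
Qed.

Lemma monomial_Aut i (a b : K) : a != 0 -> b != 0 ->
  i = ord0 \/ (q11 = q22 /\ q12 = q21) -> Aut (monomial i a b).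
Proof.
move=> a0 b0 hi; apply/AutTP; split; first exact: monomial_aut.
have sup k z : z \in msupp (img (monomial i a b) k) ->
    z = fmu (if i == ord0 then k else rev_ord k).
  rewrite /img /=; case: (ord2E k) => -> /=;
  move/(fsubsetP (msuppZ_le _ _)); rewrite (msuppU1 K) inE => /eqP ->;
  by case: (ord2E i) => -> //=; congr fmu; apply: val_inj.
move=> k l u v /sup -> /sup ->; case: (ord2E i) hi => -> //= [//|[h1 h2]].
by case: (ord2E k) => ->; case: (ord2E l) => ->;
  rewrite /bcoef !occU /= ?h1 ?h2 ?mulr1 ?mul1r.
Qed.

Lemma mcoeff_scaleX (a : K) i k :
  (a *: X K i)@_(fmu k) = if k == i then a else 0.
Proof.
rewrite mcoeffZ mcoeffU; have [->|ki] := eqVneq k i; first by rewrite eqxx mulr1.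
case: eqP => [/(congr1 (occ^~ i))|_]; last exact: mulr0.
by rewrite !occU eqxx (negbTE ki).
Qed.

Lemma coef_monomial i (a b : K) k :
  ((monomial i a b).1@_(fmu k) = if k == i then a else 0) *
  ((monomial i a b).2@_(fmu k) = if k == i then 0 else b).
Proof.
split; [exact: (mcoeff_scaleX a i k)|apply: etrans (mcoeff_scaleX b _ k) _].
case: (ord2_cases i k) => ->; rewrite ?eqxx ?rev_ord2_neq //.
by rewrite eq_sym rev_ord2_neq.
Qed.

Lemma endo_scaleX f (c : K) i : endo f (c *: X K i) = c *: img f i.
Proof. by rewrite -endoX linearZ. Qed.

(** An exchange in the second factor swaps the coefficients of the first, which is the source of the
    semidirect law. *)
Lemma ecomp_monomial i k (a b c d : K) :
  ecomp (monomial i a b) (monomial k c d) =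
  if k == ord0 then monomial i (c * a) (d * b)
  else monomial (rev_ord i) (c * b) (d * a).
Proof.
apply: etrans (congr2 pair (endo_scaleX (monomial i a b) c k)
  (endo_scaleX (monomial i a b) d (rev_ord k))) _.
have r0 : rev_ord ord0 = ord_max :> 'I_2 by apply: val_inj.
have r1 : rev_ord ord_max = ord0 :> 'I_2 by apply: val_inj.
case: (ord2E k) => ->; rewrite ?r0 ?r1 /img /= !scalerA /monomial ?rev_ordK //.
Qed.

Lemma Aut_iso_torus :
  ~ (q11 = q12 /\ q22 = q12) -> ~ (q12 = 1 /\ (q11 = 1 \/ q22 = 1)) ->
  ~ (q11 = q22 /\ q12 = q21) ->
  group_iso Aut (@ecomp K) (@KstarKstar K) (@mulKK K).
Proof.
move=> n1 n2 n3.
have form f : Aut f -> exists a b, [/\ a != 0, b != 0 & f = monomial ord0 a b].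
  move=> Af; have [i [a [b [a0 b0 ef]]]] := Aut_monomial n1 n2 Af.
  suff i0 : i = ord0.
    by exists a, b; split; [exact: a0|exact: b0|rewrite ef i0; reflexivity].
  (* A braided map that exchanges the letters would make [chi] symmetric under the exchange. *)
  case: (ord2E i) => // i1; case: n3; move/AutTP: Af => [_ bf].
  have [e11 e12 e21 e22] := bcoef_letters.
  have s0 : fmu ord_max \in msupp (img f ord0).
    by rewrite -mcoeff_neq0 ef i1 /img (coef_monomial _ _ _ _).1.
  have s1 : fmu ord0 \in msupp (img f ord_max).
    by rewrite -mcoeff_neq0 ef i1 /img (coef_monomial _ _ _ _).2.
  have := bf ord0 ord0 _ _ s0 s0; have := bf ord0 ord_max _ _ s0 s1.
  by rewrite e11 e12 e21 e22 => -> ->.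
have [h hE] : exists h : endo_pair K -> K * K,
    forall a b, h (monomial ord0 a b) = (a, b).
  exists (fun f => (f.1@_(fmu ord0), f.2@_(fmu ord_max))) => a b.
  exact: congr2 (coef_monomial _ _ _ _).1 (coef_monomial _ _ _ _).2.
(* Generalizing over [monomial] keeps unification from unfolding it. *)
have mM a b c d := ecomp_monomial ord0 ord0 a b c d.
have mA a b (a0 : a != 0) (b0 : b != 0) := monomial_Aut a0 b0 (or_introl erefl).
move: form hE mM mA; move: (@monomial K) => m form hE mM mA.
exists h; split.
- by move=> f /form[a [b [a0 b0 ->]]]; rewrite hE.
- move=> f g /form[a [b [a0 b0 ->]]] /form[c [d [c0 d0 ->]]].
  by rewrite mM !hE /mulKK /= mulrC [d * _]mulrC.
- move=> f g /form[a [b [a0 b0 ->]]] /form[c [d [c0 d0 ->]]].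
  by rewrite !hE => -[-> ->].
by move=> [a b] [/= a0 b0]; exists (m ord0 a b); split; [exact: mA|exact: hE].
Qed.

Lemma Aut_iso_semidirect :
  ~ (q11 = q12 /\ q22 = q12) -> ~ (q12 = 1 /\ (q11 = 1 \/ q22 = 1)) ->
  q11 = q22 -> q12 = q21 ->
  group_iso Aut (@ecomp K) (@SemiDir K) (@mulSD K).
Proof.
move=> n1 n2 h1 h2.
have form f : Aut f -> exists i a b, [/\ a != 0, b != 0 & f = monomial i a b].
  exact: Aut_monomial.
have [h h0 hm] : exists2 h : endo_pair K -> K * K * bool,
    forall a b, a != 0 -> h (monomial ord0 a b) = ((a, b), false)
  & forall a b, h (monomial ord_max a b) = ((b, a), true).
  (* Coefficients are grouped by the letter they multiply, not by component, to match the order of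
     factors in [mulSD]. A vanishing coefficient of [x_1] in [f.1] detects the exchange. *)
  pose h f := ((f.1@_(fmu ord0) + f.2@_(fmu ord0),
    f.1@_(fmu ord_max) + f.2@_(fmu ord_max)), f.1@_(fmu ord0) == 0).
  have hE i a b : h (monomial i a b) = (((if ord0 == i then a else 0) +
      (if ord0 == i then 0 else b), (if ord_max == i then a else 0) +
      (if ord_max == i then 0 else b)), (if ord0 == i then a else 0) == 0).
    have e k := (coef_monomial i a b k).1; have e' k := (coef_monomial i a b k).2.
    apply: (congr2 pair); last exact: (congr1 (fun x => x == 0) (e ord0)).
    apply: (congr2 pair); first exact: (congr2 +%R (e ord0) (e' ord0)).
    exact: (congr2 +%R (e ord_max) (e' ord_max)).
  exists h => a b; last by rewrite hE /= addr0 add0r eqxx.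
  by move=> a0; rewrite hE /= addr0 add0r (negbTE a0).
have mM i k a b c d := ecomp_monomial i k a b c d.
have mA i a b (a0 : a != 0) (b0 : b != 0) :=
  @monomial_Aut i a b a0 b0 (or_intror (conj h1 h2)).
move: form h0 hm mM mA; move: (@monomial K) => m form h0 hm mM mA.
have r1 : rev_ord ord_max = ord0 :> 'I_2 by apply: val_inj.
have r0 : rev_ord ord0 = ord_max :> 'I_2 by apply: val_inj.
exists h; split.
- move=> f /form[i [a [b [a0 b0 ->]]]].
  by case: (ord2E i) => ->; rewrite ?h0 ?hm.
- move=> f g /form[i [a [b [a0 b0 ->]]]] /form[k [c [d [c0 d0 ->]]]].
  rewrite mM; case: (ord2E i) => ->; case: (ord2E k) => -> /=;
    rewrite ?r0 ?r1 ?h0 ?hm ?mulf_neq0 // /mulSD /mulKK /=;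
    by rewrite [c * _]mulrC [d * _]mulrC.
- move=> f g /form[i [a [b [a0 b0 ->]]]] /form[k [c [d [c0 d0 ->]]]].
  by case: (ord2E i) => ->; case: (ord2E k) => ->; rewrite ?h0 ?hm // => -[-> ->].
move=> [[a b] e] [/= a0 b0]; case: e.
  by exists (m ord_max b a); split; [exact: mA|exact: hm].
by exists (m ord0 a b); split; [exact: mA|exact: h0].
Qed.

(** Comparing a word with itself determines its parity in the other letter, as a square has the
    parity of its root; conversely [chi] depends only on these parities. *)
Lemma Aut_triangular i f :
  (forall u v, chi u v = (-1) ^+ (occ u (rev_ord i) * occ v (rev_ord i))) ->
  Aut f <-> triangular i f.
Proof.
move=> chiE; split=> [/AutTP[autf bf]|tf].
  apply: even_odd_triangular => //; split=> z zf.
    have /eqP := bf i i z z zf zf; rewrite !chiE !occU [i == _]eq_sym rev_ord2_neq.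
    by rewrite mul0n expr0 sign_eq1 oddM andbb.
  have /eqP := bf _ _ z z zf zf; rewrite !chiE !occU eqxx.
  by rewrite expr1 sign_eqN1 oddM andbb.
apply/AutTP; split; first exact: triangular_aut tf.
have [evenf oddf] := triangular_even_odd tf.
have par k z : z \in msupp (img f k) ->
    odd (occ z (rev_ord i)) = odd (occ (fmu k) (rev_ord i)).
  case: (ord2_cases i k) => -> zf; rewrite occU.
    by rewrite [i == _]eq_sym rev_ord2_neq; apply: negbTE; apply: evenf.
  by rewrite eqxx; apply: oddf.
move=> k l u v uk vl; rewrite !chiE -signr_odd -[RHS]signr_odd !oddM.
by rewrite (par k u) ?(par l v).
Qed.

Lemma Aut_iso_G4 : q12 = 1 -> q11 * q22 = -1 ->
  group_iso Aut (@ecomp K) (@G4 K) (@ecomp K).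
Proof.
have r1 : rev_ord ord_max = ord0 :> 'I_2 by apply: val_inj.
have r0 : rev_ord ord0 = ord_max :> 'I_2 by apply: val_inj.
case: hinv => /eqP; rewrite sqrf_eq1 => /orP[] /eqP e11 _ h12 e12 e1122.
  (* Here [q11 = 1] and [q22 = -1], and the group is [G4] itself. *)
  have AutE f : Aut f <-> G4 f.
    rewrite -triangular_G4; apply: Aut_triangular => u v; rewrite r0 /bcoef.
    move: h12 e1122; rewrite e12 e11 !mul1r => -> ->.
    by rewrite !expr1n !mul1r.
  exists id; split=> // [f /AutE //|z /AutE Az].
  by exists z.
(* Here [q11 = -1] and [q22 = 1]: the letters change roles, and conjugation by [swap] leads back to
   [G4]. *)
have AutE f : Aut f <-> triangular ord_max f.
  apply: Aut_triangular => u v; rewrite r1 /bcoef.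
  move: h12 e1122; rewrite e12 e11 !mul1r mulN1r => -> /oppr_inj ->.
  by rewrite !expr1n !mulr1.
exists (@swap_conj K); split.
- by move=> f /AutE/triangular_swap; rewrite r1 => /triangular_G4.
- by move=> f g _ _; rewrite swap_conjM.
- move=> f g _ _ e; apply: etrans (esym (swap_conjK f)) _.
  exact: etrans (congr1 (@swap_conj K) e) (swap_conjK g).
move=> z /triangular_G4/triangular_swap; rewrite r0 => /AutE Az.
by exists (swap_conj z); split; [exact: Az|exact: swap_conjK].
Qed.

Lemma Aut_trivial f : q11 = 1 -> q12 = 1 -> q21 = 1 -> q22 = 1 ->
  Aut f <-> is_aut f.
Proof.
move=> e11 e12 e21 e22; rewrite AutTP; split=> [[]//|autf]; split=> // k l u v _ _.
by rewrite /bcoef e11 e12 e21 e22 !expr1n.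
Qed.

Lemma Aut_odd f : q11 = -1 -> q12 = -1 -> q21 = -1 -> q22 = -1 ->
  Aut f <-> Godd f.
Proof.
move=> e11 e12 e21 e22.
have chiE u v : chi u v = (-1) ^+ (size u * size v).
  rewrite /bcoef e11 e12 e21 e22 -!exprD !(size_occ ord0).
  rewrite (_ : rev_ord ord0 = ord_max); last exact: val_inj.
  by congr (_ ^+ _); rewrite mulnDl !mulnDr !addnA.
rewrite AutTP /Godd; split=> -[autf h]; split=> //.
  by split; apply/allP => z zf; [have /eqP := h ord0 ord0 z z zf zf
    | have /eqP := h ord_max ord_max z z zf zf];
  rewrite !chiE !fmU sign_eqN1 oddM andbb.
case: h => /allP o1 /allP o2.
have par k z : z \in msupp (img f k) -> odd (size z).
  by case: (ord2E k) => -> zf; [apply: o1|apply: o2].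
move=> k l u v uk vl; rewrite !chiE !fmU -signr_odd oddM.
by rewrite (par k u) ?(par l v).
Qed.
End InvolutiveBraiding.

Theorem theorem1 (K : fieldType) (charK : 2%N \notin [pchar K])
    (q11 q12 q21 q22 : K)
    (hinv : [/\ q11 ^+ 2 = 1, q22 ^+ 2 = 1 & q12 * q21 = 1]) :
  [/\ (* (1) *)
      (q11 = 1 /\ q12 = 1 /\ q21 = 1 /\ q22 = 1 ->
         forall f : endo_pair K, AutT q11 q12 q21 q22 f <-> is_aut f),
      (* (2) *)
      (q11 = -1 /\ q12 = -1 /\ q21 = -1 /\ q22 = -1 ->
         forall f : endo_pair K, AutT q11 q12 q21 q22 f <-> Godd f),
      (* (3) *)
      (q11 = q22 /\ q12 = q21 /\ q11 * q12 = -1 ->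
         group_iso (AutT q11 q12 q21 q22) (@ecomp K) (@SemiDir K) (@mulSD K)),
      (* (4) *)
      (q12 = 1 /\ q11 * q22 = -1 ->
         group_iso (AutT q11 q12 q21 q22) (@ecomp K) (@G4 K) (@ecomp K))
    & (* (5) *)
      ((q12 != 1 /\ q12 != -1) \/ (q12 = -1 /\ q11 * q22 = -1) ->
         group_iso (AutT q11 q12 q21 q22) (@ecomp K) (@KstarKstar K) (@mulKK K))].
Proof.
have N1 := opp1_neq1 charK; have [s11 s22 s12] := hinv.
split.
- by case=> e11 [e12 [e21 e22]] f; apply: Aut_trivial.
- by case=> e11 [e12 [e21 e22]] f; apply: Aut_odd.
- case=> e1122 [e1221 e1112]; apply: Aut_iso_semidirect => //.
    (* [q11 = q12] would turn [q11 * q12 = -1] into [1 = -1]. *)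
    by case=> e _; move: e1112 N1; rewrite -e -expr2 s11 => <-; rewrite eqxx.
  case=> e12 e; have {}e : q11 = 1 by case: e; rewrite ?e1122.
  by move: e1112 N1; rewrite e12 e mulr1 => <-; rewrite eqxx.
- by case; apply: Aut_iso_G4.
(* Each of the three excluded patterns leads to [q12] being 1 or -1 in the first alternative, and to
   [1 = -1] in the second. *)
move=> h; apply: Aut_iso_torus => //.
- case=> e11 e22; case: h => [[n1 n2]|[e12 e]].
    have /eqP := s11; rewrite e11 sqrf_eq1.
    by rewrite (negbTE n1) (negbTE n2).
  by move: e N1; rewrite e11 e22 -expr2 -e11 s11 => <-; rewrite eqxx.
- case=> e12 _; case: h => [[]|[]]; rewrite e12 ?eqxx // => e _.
  by rewrite -e eqxx in N1.
case=> e1122 e1221; case: h => [[n1 n2]|[e12 e]].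
  have /eqP := s12; rewrite -e1221 -expr2 sqrf_eq1.
  by rewrite (negbTE n1) (negbTE n2).
by move: e N1; rewrite -e1122 -expr2 s11 => <-; rewrite eqxx.
Qed.
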